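(* Let $M$ be a closed connected surface with a triangulation $\mathcal{T}=\{V,E,F\}$, $V=\{1,\dots,N\}$, let $I:E\to[0,+\infty)$ be an inversive distance, and let $\alpha\in\mathbb{R}$. Assume there exists a generalized metric in $\mathbb{R}^N_{>0}$ with constant extended $\alpha$-curvature. If $\chi(M)>0$, then $\overline{Y}\cap\mathbb{R}^N_{>0}\ne\emptyset$; if $\chi(M)<0$, then $\overline{Y}\cap\mathbb{R}^N_{<0}\neq\emptyset$; if $\chi(M)=0$, then $\overline{Y}\cap\{0\}\ne\emptyset$.
   Context: $V,E,F$ are the vertices, edges and faces of $\mathcal{T}$, $N=|V|$. Any $r\in\mathbb{R}^N_{>0}$ is called a generalized (extended) metric; each edge $\{ij\}\in E$ gets length $l_{ij}=\sqrt{r_i^2+r_j^2+2r_ir_jI_{ij}}$. The generalized inner angles $\tilde\theta_i^{jk}$ of a face $\{ijk\}\in F$ are: the Euclidean inner angles of the triangle with edge lengths $l_{ij},l_{jk},l_{ik}$ if these satisfy the three strict triangle inequalities; and if $l_{jk}\ge l_{ij}+l_{ik}$ then $\tilde\theta_i^{jk}=\pi$ and the angles at $j$ and $k$ are $0$ (similarly for the other vertices). The extended curvature is $\widetilde K_i=2\pi-\sum_{\{ijk\}\in F}\tilde\theta_i^{jk}$ (sum over the triangles having $i$ as a vertex), and the extended $\alpha$-curvature at $i$ is $\widetilde K_i/r_i^\alpha$; it is constant if it is the same for all $i\in V$. For nonempty proper $A\subset V$: $F_A$ is the subcomplex of $\mathcal{T}$ consisting of all cells whose vertices are all in $A$, and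 $\chi(F_A)$ is its Euler characteristic; $Lk(A)$ is the set of pairs $(e,v)$ of an edge $e$ and a vertex $v$ such that (1) the end points of $e$ are not in $A$, (2) $v\in A$, (3) $e$ and $v$ form a triangle of $\mathcal{T}$. $\Lambda(x)=\pi$ for $x\le-1$, $\Lambda(x)=\arccos x$ for $-1\le x\le 1$, $\Lambda(x)=0$ for $x\ge1$. Put $Y_A=\{x\in\mathbb{R}^N\mid\sum_{i\in A}x_i>-\sum_{(e,v)\in Lk(A)}(\pi-\Lambda(I_e))+2\pi\chi(F_A)\}$ and $Y=\{x\in\mathbb{R}^N\mid\sum_{i\in V}x_i=2\pi\chi(M)\}\cap\bigcap_{\emptyset\ne A\subsetneq V}Y_A$; $\overline{Y}$ is the closure of $Y$ in $\mathbb{R}^N$. $\mathbb{R}^N_{>0}$ and $\mathbb{R}^N_{<0}$ are the sets of vectors with all coordinates positive, respectively negative. *)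

(* Defs.v *)
From HB Require Import structures.
From mathcomp Require Import all_boot all_order all_algebra.
From mathcomp Require Import all_classical all_reals all_analysis.

Set Implicit Arguments.
Unset Strict Implicit.
Unset Printing Implicit Defensive.

Import Order.TTheory GRing.Theory Num.Theory.
Import numFieldNormedType.Exports.

Local Open Scope classical_set_scope.
Local Open Scope ring_scope.

(** The vertices {1, ..., N} are the elements of ['I_N]; an edge {ij} is the
    set [[set i; j]], a face {ijk} the set [[set i; j; k]]. *)
Record complex2 (N : nat) := Complex2 {
  edges : {set {set 'I_N}};
  faces : {set {set 'I_N}};
  card_edge : forall e, e \in edges -> #|e| = 2%N;
  card_face : forall f, f \in faces -> #|f| = 3%N;
  face_edge : forall f e : {set 'I_N},
    f \in faces -> e \subset f -> #|e| = 2%N -> e \in edges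
}.

(** The link of [v] is the simple closed polygon running through [c]: its
    vertices are the [j] with {vj} an edge, its edges the {jk} with {vjk} a
    face. *)
Definition link_is_cycle (N : nat) (T : complex2 N) (v : 'I_N)
    (c : seq 'I_N) : Prop :=
  [/\ uniq c, (2 < size c)%N,
      forall j, ([set v; j]%SET \in edges T) = (j \in c) &
      forall j k, ([set v; j; k]%SET \in faces T) =
        [&& j \in c, k \in c & (k == next c j) || (j == next c k)]].

(** [T] triangulates a (nonempty) closed connected surface. *)
Definition closed_connected_surface (N : nat) (T : complex2 N) : Prop :=
  [/\ (0 < N)%N,
      forall v, exists c, link_is_cycle T v c &
      forall i j, connect (fun a b => [set a; b]%SET \in edges T) i j].

Definition cells (N : nat) (T : complex2 N) : {set {set 'I_N}} :=
  [set [set v]%SET | v : 'I_N]%SET :|: edges T :|: faces T.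

Definition subcomplex (N : nat) (T : complex2 N) (A : {set 'I_N}) :
    {set {set 'I_N}} :=
  [set s in cells T | s \subset A]%SET.

(** A cell with n vertices has dimension n - 1. *)
Definition euler_char (N : nat) (K : {set {set 'I_N}}) : int :=
  \sum_(s in K) (-1) ^+ (#|s|.-1).

Definition Lk (N : nat) (T : complex2 N) (A : {set 'I_N}) :
    {set {set 'I_N} * 'I_N} :=
  [set p | [&& p.1 \in edges T, [disjoint p.1 & A], p.2 \in A
             & (p.2 |: p.1)%SET \in faces T]]%SET.

Section Geometry.
Variable R : realType.

Definition Lambda (x : R) : R :=
  if x <= -1 then pi else if x <= 1 then acos x else 0.

(** The generalized angle, between the sides of lengths [b] and [c] and
    opposite to [a], of a triangle with side lengths [a], [b], [c] (law of
    cosines when the strict triangle inequalities hold). *)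
Definition ext_angle (a b c : R) : R :=
  if b + c <= a then pi
  else if (a + c <= b) || (a + b <= c) then 0
  else acos ((b ^+ 2 + c ^+ 2 - a ^+ 2) / (2 * b * c)).

Variables (N : nat) (T : complex2 N).

(** The inversive distance; only its values on [edges T] matter. *)
Variable I : {set 'I_N} -> R.

Definition edge_length (r : 'rV[R]_N) (i j : 'I_N) : R :=
  Num.sqrt (r ord0 i ^+ 2 + r ord0 j ^+ 2
            + 2 * r ord0 i * r ord0 j * I [set i; j]%SET).

Definition inner_angle (r : 'rV[R]_N) (i j k : 'I_N) : R :=
  ext_angle (edge_length r j k) (edge_length r i j) (edge_length r i k).

(** A face {ijk} at [i] is counted once, through its pair [j < k]. *)
Definition ext_curvature (r : 'rV[R]_N) (i : 'I_N) : R :=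
  2 * pi - \sum_(j < N) \sum_(k < N | (j < k)%N
                               && ([set i; j; k]%SET \in faces T))
             inner_angle r i j k.

Definition ext_alpha_curvature (alpha : R) (r : 'rV[R]_N) (i : 'I_N) : R :=
  ext_curvature r i / (r ord0 i `^ alpha).

Definition Y_ (A : {set 'I_N}) : set 'rV[R]_N :=
  [set x : 'rV[R]_N | - (\sum_(p in Lk T A) (pi - Lambda (I p.1)))
           + 2 * pi * (euler_char (subcomplex T A))%:~R
           < \sum_(i in A) x ord0 i].

Definition Y : set 'rV[R]_N :=
  [set x : 'rV[R]_N | \sum_i x ord0 i = 2 * pi * (euler_char (cells T))%:~R] `&`
  \bigcap_(A in [set A : {set 'I_N} |
                  A != finset.set0 /\ A \proper [set: 'I_N]%SET]) Y_ A.

End Geometry.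

Definition pos_orthant (R : realType) (N : nat) : set 'rV[R]_N :=
  [set x : 'rV[R]_N | forall i, 0 < x ord0 i].

Definition neg_orthant (R : realType) (N : nat) : set 'rV[R]_N :=
  [set x : 'rV[R]_N | forall i, x ord0 i < 0].

Arguments pos_orthant {R N} _.
Arguments neg_orthant {R N} _.

(* Main.v *)
Require Import Defs.
From HB Require Import structures.
From mathcomp Require Import all_boot all_order all_algebra.
From mathcomp Require Import all_classical all_reals all_analysis.
From mathcomp Require Import ring lra.

Import Order.TTheory GRing.Theory Num.Theory.
Import numFieldNormedType.Exports.

Local Open Scope classical_set_scope.
Local Open Scope ring_scope.

(** The point found in the closure of [Y] is the extended curvature vector K
    of the given metric r. Constant alpha-curvature c means that
    K_i = c r_i^alpha, and Gauss-Bonnet, sum_i K_i = 2 pi chi(M)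
    ([angle_curvature_total]), says that c has the sign of chi(M); so K lies in
    the orthant, or at the origin, that the three cases ask for. What has to be
    proved is that the extended curvature of every generalized metric belongs
    to the closure of [Y] ([ext_curvature_closure]).

    Gauss-Bonnet and the inequalities defining [Y] do not need the angles to come
    from a metric. Call [angle_system] any choice of three numbers
    with sum pi at the corners of each face. Summing the resulting curvature
    over a set A of vertices, and using that every edge lies in exactly two
    faces, gives the expression
    - sum_(Lk A) (pi - Lambda I) + 2 pi chi(F_A) up to a sum over the faces of a
    term [slack] that depends only on the angles and inversive distances of the
    face ([sum_angle_curvature]). On a face with all or none of its vertices in A the
    slack vanishes; with two vertices in A it is the third angle; with one
    vertex in A, opposite to the edge e, it is pi - Lambda (I e) minus the angle
    there. So if every angle lies strictly between 0 and pi - Lambda (I e), the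
    curvature vector is in [Y] ([angle_curvature_in_Y]): connectedness provides
    a face that meets both A and its complement, whence a strict inequality.

    The generalized angles of r satisfy these bounds in the weak sense
    ([inner_angle_bounds], by the law of cosines). As I >= 0, the quantity
    pi - Lambda (I e) is at least pi / 2, so the constant angles pi / 3 satisfy
    them strictly, and so does every mixture (1 - t) theta + t pi / 3 with
    0 < t < 1. The curvature of these mixtures lies in [Y] and tends to K as t
    tends to 0. *)

(** * Angles of generalized triangles *)

Lemma ler_acos (R : realType) (x y : R) :
  -1 <= x <= 1 -> -1 <= y <= 1 -> x <= y -> acos y <= acos x.
Proof.
move=> hx hy xy; rewrite leNgt; apply/negP => lt.
have ix : acos x \in `[0, pi] by rewrite in_itv /= acos_ge0 ?acos_lepi.
have iy : acos y \in `[0, pi] by rewrite in_itv /= acos_ge0 ?acos_lepi.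
by move: lt; rewrite -(ltr_cos ix iy) !acosK ?in_itv //= ltNge xy.
Qed.

(** The cubic relation is the vanishing of the Gram determinant of three unit
    vectors with pairwise cosines [-x], [-y], [-z]: it gives
    cos (acos x + acos y) = - z once the sign of [x * y + z] is known, and
    [0 <= x + y] keeps acos x + acos y in [0, pi], where cos is injective. *)
Lemma acos_sum_pi (R : realType) (x y z : R) :
  -1 <= x <= 1 -> -1 <= y <= 1 -> -1 <= z <= 1 ->
  0 <= x + y -> 0 <= x * y + z ->
  x ^+ 2 + y ^+ 2 + z ^+ 2 + 2 * x * y * z = 1 ->
  acos x + acos y + acos z = pi.
Proof.
move=> hx hy hz xy0 xyz0 gram.
have ? := acos_ge0 hx; have ? := acos_ge0 hy.
have ? := acos_ge0 hz; have ? := acos_lepi hz.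
have le_pi : acos x <= pi - acos y.
  by rewrite -acosN //; apply: ler_acos => //; lra.
suff -> : acos x + acos y = pi - acos z by rewrite subrK.
apply: cos_inj; rewrite ?in_itv /=; [lra|lra|].
rewrite cosD !acosK ?in_itv // !sin_acos // cosB cospi sinpi acosK ?in_itv //.
rewrite mul0r addr0 mulN1r -sqrtrM; last by nra.
have -> : (1 - x ^+ 2) * (1 - y ^+ 2) = (x * y + z) ^+ 2 by lra.
by rewrite sqrtr_sqr ger0_norm //; ring.
Qed.

Lemma ext_angleC (R : realType) (a b c : R) : ext_angle a b c = ext_angle a c b.
Proof.
rewrite /ext_angle [c + b]addrC orbC [b ^+ 2 + _]addrC.
by rewrite [2 * b * c]mulrAC.
Qed.

Lemma cos_law_bounds (R : realType) (a b c : R) : 0 < b -> 0 < c ->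
  a < b + c -> b < a + c -> c < a + b ->
  -1 <= (b ^+ 2 + c ^+ 2 - a ^+ 2) / (2 * b * c) <= 1.
Proof.
move=> b0 c0 ha hb hc.
have bc0 : 0 < 2 * b * c by nra.
by rewrite ler_pdivlMr // ler_pdivrMr //; apply/andP; split; nra.
Qed.

Lemma ext_angle_ge0 (R : realType) (a b c : R) : 0 < b -> 0 < c ->
  0 <= ext_angle a b c.
Proof.
move=> b0 c0; rewrite /ext_angle.
case: (leP (b + c) a) => ha; first exact: pi_ge0.
case: (leP (a + c) b) => //= hb; case: (leP (a + b) c) => //= hc.
by apply: acos_ge0; apply: cos_law_bounds.
Qed.

(** At most one of the three triangle inequalities can fail, in which case the
    angles are pi, 0, 0. Otherwise Heron's product
    (a + b + c) (b + c - a) (a + c - b) (a + b - c) > 0 provides the sign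
    conditions of [acos_sum_pi] for the three cosines. *)
Lemma ext_angle_sum (R : realType) (a b c : R) : 0 < a -> 0 < b -> 0 < c ->
  ext_angle a b c + ext_angle b a c + ext_angle c a b = pi.
Proof.
move=> a0 b0 c0; rewrite /ext_angle.
have F (x y : R) : y < x -> (x <= y) = false.
  by move=> ?; apply/negbTE; rewrite -ltNge.
case: (leP (b + c) a) => ha.
  rewrite (F (a + c) b) ?(F (a + b) c); try lra.
  by rewrite [c + b]addrC ha /= !addr0.
case: (leP (a + c) b) => hb /=.
  rewrite (F (a + b) c) /=; last by lra.
  by rewrite [c + a]addrC hb orbT add0r addr0.
case: (leP (a + b) c) => hc /=; first by rewrite [b + a]addrC hc !add0r.
rewrite (F (b + a) c) ?(F (c + b) a) ?(F (c + a) b) /=; try lra.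
have P1 : 0 < 2 * b * c by nra.
have P2 : 0 < 2 * a * c by nra.
have b' : b != 0 by rewrite gt_eqF.
have c' : c != 0 by rewrite gt_eqF.
have a' : a != 0 by rewrite gt_eqF.
have P : 0 < 4 * a * b * c ^+ 2 by rewrite !mulr_gt0 ?exprn_gt0.
apply: acos_sum_pi.
- by apply: cos_law_bounds; lra.
- by apply: cos_law_bounds; lra.
- by apply: cos_law_bounds; lra.
- have -> : (b ^+ 2 + c ^+ 2 - a ^+ 2) / (2 * b * c) +
    (a ^+ 2 + c ^+ 2 - b ^+ 2) / (2 * a * c)
    = (a + b) * (c - a + b) * (c + a - b) / (2 * a * b * c).
    by field; rewrite ?b' ?c' ?a'.
  by rewrite divr_ge0 // !mulr_ge0 ?ltW //; lra.
- have -> : (b ^+ 2 + c ^+ 2 - a ^+ 2) / (2 * b * c) *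
    ((a ^+ 2 + c ^+ 2 - b ^+ 2) / (2 * a * c)) +
    (a ^+ 2 + b ^+ 2 - c ^+ 2) / (2 * a * b)
    = (a + b + c) * (b + c - a) * (a + c - b) * (a + b - c)
      / (4 * a * b * c ^+ 2).
    by field; rewrite ?b' ?c' ?a'.
  by rewrite divr_ge0 ?(ltW P) // !mulr_ge0 ?ltW //; lra.
- by field; rewrite ?b' ?c' ?a'.
Qed.

Lemma acos_le_pi_sub_Lambda (R : realType) (x y : R) :
  -1 <= x <= 1 -> 0 <= y -> (y <= 1 -> - y <= x) -> acos x <= pi - Lambda y.
Proof.
move=> hx y0 hyx; rewrite /Lambda.
have -> : (y <= -1) = false by apply/negbTE; rewrite -ltNge; lra.
case: (leP y 1) => y1; last by rewrite subr0 acos_lepi.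
have hy : -1 <= y <= 1 by lra.
by rewrite -acosN //; apply: ler_acos => //; [lra|exact: hyx].
Qed.

(** The triangle has a circle of radius [x] at the vertex of the angle, circles
    of radii [y], [z] at the other two, with inversive distance [J] between
    them. That the inversive distances on the sides [b] and [c] are nonnegative
    enters through [b ^+ 2 >= x ^+ 2 + y ^+ 2] and
    [c ^+ 2 >= x ^+ 2 + z ^+ 2]: they give
    [b ^+ 2 + c ^+ 2 - a ^+ 2 >= - 2 * y * z * J >= - 2 * b * c * J], that is,
    a cosine at least [- J]. The angle can equal pi only when [J > 1], because
    [J <= 1] makes the side [a] at most [y + z < b + c]. *)
Lemma ext_angle_le_pi_sub_Lambda (R : realType) (x y z J b c : R) :
  0 < x -> 0 < y -> 0 < z -> 0 <= J ->
  Num.sqrt (x ^+ 2 + y ^+ 2) <= b -> Num.sqrt (x ^+ 2 + z ^+ 2) <= c ->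
  ext_angle (Num.sqrt (y ^+ 2 + z ^+ 2 + 2 * y * z * J)) b c <= pi - Lambda J.
Proof.
move=> x0 y0 z0 J0 hb hc.
set d := Num.sqrt _.
have yz0 : 0 < y * z by rewrite mulr_gt0.
have sq : 0 <= y ^+ 2 + z ^+ 2 + 2 * y * z * J by nra.
have d2 : d ^+ 2 = y ^+ 2 + z ^+ 2 + 2 * y * z * J by rewrite sqr_sqrtr.
have d0 : 0 <= d by rewrite sqrtr_ge0.
have leg (t u : R) : 0 < t -> Num.sqrt (x ^+ 2 + t ^+ 2) <= u ->
    0 < u /\ x ^+ 2 + t ^+ 2 <= u ^+ 2.
  move=> t0 htu.
  have s0 : 0 < x ^+ 2 + t ^+ 2 by nra.
  split; first by apply: lt_le_trans htu; rewrite sqrtr_gt0.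
  have s1 := sqrtr_ge0 (x ^+ 2 + t ^+ 2); have := sqr_sqrtr (ltW s0); nra.
have [b0 b2] := leg _ _ y0 hb; have [c0 c2] := leg _ _ z0 hc.
have yb : y < b by nra.
have zc : z < c by nra.
have J1 : b + c <= d -> 1 < J by move=> bcd; nra.
rewrite /ext_angle.
have L0 : Lambda J <= pi.
  rewrite /Lambda; case: (leP J (-1)) => // _; case: (leP J 1) => J1';
    last exact: pi_ge0.
  by rewrite acos_lepi //; lra.
case: (leP (b + c) d) => hd.
  rewrite /Lambda (leNgt J 1) J1 //=.
  have -> : (J <= -1) = false.
    by apply/negbTE; rewrite -ltNge; have := J1 hd; lra.
  by rewrite subr0.
case: (leP (d + c) b) => hb' /=; first by lra.
case: (leP (d + b) c) => hc' /=; first by lra.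
apply: acos_le_pi_sub_Lambda => // [|_]; first exact: cos_law_bounds.
rewrite ler_pdivlMr; last by nra.
have yzbc : y * z <= b * c by rewrite ler_pM // ltW.
have := ler_wpM2l J0 yzbc; have := sqr_ge0 x; rewrite d2; lra.
Qed.

(** * Counting edges and faces through ordered tuples *)

Section Counting.
Context {R : comNzRingType} {N : nat}.
Implicit Types (i j k : 'I_N) (e f : {set 'I_N}) (P : {set {set 'I_N}}).

Lemma sum_pred1 i (g : 'I_N -> R) : \sum_j (j == i)%:R * g j = g i.
Proof.
rewrite (bigD1 i) //= eqxx mul1r big1 ?addr0 // => j /negbTE ->.
by rewrite mul0r.
Qed.

Lemma sum_orderings2 e : #|e| = 2%N ->
  \sum_i \sum_j ([set i; j]%SET == e)%:R = 2 :> R.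
Proof.
move=> /eqP/cards2P[x [y [xy ->]]].
have E i j : ([set i; j]%SET == [set x; y]%SET)%:R =
    (i == x)%:R * (j == y)%:R + (i == y)%:R * (j == x)%:R :> R.
  rewrite -!natrM !mulnb -natrD; congr (_%:R).
  have -> : ([set i; j]%SET == [set x; y]%SET) =
      ((i == x) && (j == y)) || ((i == y) && (j == x)).
    apply/eqP/orP => [h|[] /andP[/eqP -> /eqP ->] //]; last first.
      by rewrite finset.setUC.
    have : i \in [set x; y]%SET by rewrite -h !inE eqxx.
    have : j \in [set x; y]%SET by rewrite -h !inE eqxx orbT.
    have : x \in [set i; j]%SET by rewrite h !inE eqxx.
    have : y \in [set i; j]%SET by rewrite h !inE eqxx orbT.
    rewrite !inE => /orP[]/eqP ? /orP[]/eqP ? /orP[]/eqP ? /orP[]/eqP ?; subst;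
      rewrite ?eqxx ?orbT //= in xy *; by auto.
  case: (eqVneq i x) => [->|] /=; first by rewrite (negbTE xy) /= orbF addn0.
  by rewrite add0n.
have S (x' : 'I_N) : \sum_j (j == x')%:R = 1 :> R.
  rewrite -[RHS](sum_pred1 x' (fun=> 1)).
  by under [RHS]eq_bigr do rewrite mulr1.
under eq_bigr => i _ do under eq_bigr => j _ do rewrite E.
under eq_bigr => i _ do rewrite big_split /= -!big_distrr /= !S !mulr1.
by rewrite big_split /= !S.
Qed.

(** For [i] in [f] the pairs [(j, k)] completing [i] to [f] are the two
    orderings of [f :\ i]. *)
Lemma sum_orderings3 f : #|f| = 3%N ->
  \sum_i \sum_j \sum_k ([set i; j; k]%SET == f)%:R = 6 :> R.
Proof.
move=> cf.
have E i j k : ([set i; j; k]%SET == f)%:R =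
    (i \in f)%:R * ([set j; k]%SET == (f :\ i)%SET)%:R :> R.
  rewrite -natrM mulnb; congr (_%:R); congr nat_of_bool.
  apply/eqP/andP => [h|[fi /eqP h]].
    have ijk : i \notin [set j; k]%SET.
      apply/negP => hi; move: cf; rewrite -h.
      have -> : [set i; j; k]%SET = [set j; k]%SET.
        apply/finset.setP => x; move: hi; rewrite !inE => hi.
        by case: (eqVneq x i) => [->|].
      by rewrite cards2; case: (_ != _).
    rewrite -h; split; first by rewrite !inE eqxx.
    apply/eqP/finset.setP => x; move: ijk; rewrite !inE => ijk.
    by case: (eqVneq x i) => [->|]; rewrite ?(negbTE ijk).
  apply/finset.setP => x; have := congr1 (fun A : {set 'I_N} => x \in A) h.
  by rewrite !inE -orbA => ->; case: (eqVneq x i) => [->|].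
under eq_bigr => i _ do under eq_bigr => j _ do
  under eq_bigr => k _ do rewrite E.
have F i : \sum_j \sum_k (i \in f)%:R * ([set j; k]%SET == (f :\ i)%SET)%:R
    = (i \in f)%:R * 2 :> R.
  under eq_bigr do rewrite -big_distrr /=.
  rewrite -big_distrr /=; case: (boolP (i \in f)) => fi; last by rewrite !mul0r.
  rewrite sum_orderings2 //.
  by apply/eqP; move: (cardsD1 i f); rewrite cf fi add1n => -[<-].
under eq_bigr do rewrite F.
rewrite -big_distrl /=.
have -> : \sum_i (i \in f)%:R = #|f|%:R :> R.
  rewrite -sum1_card natr_sum [RHS]big_mkcond.
  by apply: eq_bigr => i _; case: (i \in f).
by rewrite cf -natrM.
Qed.

Lemma sum_indicator (X : finType) (P : {set X}) (g : X -> R) x :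
  (x \in P)%:R * g x = \sum_(e in P) (x == e)%:R * g e.
Proof.
rewrite big_mkcond (bigD1 x) //= eqxx mul1r big1 ?addr0 => [|e].
  by case: (x \in P); rewrite ?mul1r ?mul0r.
by rewrite eq_sym => /negbTE ->; rewrite mul0r if_same.
Qed.

Lemma sum_pairs P (g : {set 'I_N} -> R) : (forall e, e \in P -> #|e| = 2%N) ->
  \sum_i \sum_j ([set i; j]%SET \in P)%:R * g [set i; j]%SET
  = 2 * \sum_(e in P) g e.
Proof.
move=> cP; under eq_bigr do under eq_bigr do rewrite sum_indicator.
under eq_bigr do rewrite exchange_big /=.
rewrite exchange_big big_distrr /=; apply: eq_bigr => e /cP ce.
under eq_bigr do rewrite -big_distrl /=.
by rewrite -big_distrl /= sum_orderings2.
Qed.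

Lemma sum_triples P : (forall f, f \in P -> #|f| = 3%N) ->
  \sum_i \sum_j \sum_k ([set i; j; k]%SET \in P)%:R = 6 * (#|P|%:R) :> R.
Proof.
move=> cP; rewrite -sumr_const big_distrr /=.
have E i j k : ([set i; j; k]%SET \in P)%:R =
    \sum_(f in P) ([set i; j; k]%SET == f)%:R :> R.
  rewrite -[LHS]mulr1 (sum_indicator _ _ (fun=> 1)).
  by under eq_bigr do rewrite mulr1.
under eq_bigr do under eq_bigr do
  (under eq_bigr do rewrite E; rewrite exchange_big /=).
under eq_bigr do rewrite exchange_big /=.
rewrite exchange_big /=; apply: eq_bigr => f /cP cf.
by rewrite sum_orderings3 // mulr1.
Qed.
End Counting.

(** * Combinatorics of a triangulated surface *)

Section Surface.
Context {N : nat} (T : complex2 N).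
Implicit Types i j k : 'I_N.

Definition is_face i j k := [set i; j; k]%SET \in faces T.

Lemma is_face_swap i j k : is_face i j k = is_face i k j.
Proof. by rewrite /is_face finset.setUAC. Qed.

Lemma is_face_rot i j k : is_face i j k = is_face j k i.
Proof. by rewrite /is_face -finset.setUA finset.setUC. Qed.

Lemma is_face_neq i j k : is_face i j k -> i != j.
Proof.
move=> /card_face h; apply/eqP => ij; move: h.
by rewrite ij finset.setUid cards2; case: (_ != _).
Qed.

Lemma is_face_edge i j k : is_face i j k -> [set i; j]%SET \in edges T.
Proof.
move=> h; apply: (face_edge h); first by rewrite finset.subsetUl.
by rewrite cards2 (is_face_neq _ _ _ h).
Qed.

Lemma next_neq_prev (X : eqType) (c : seq X) x :
  uniq c -> (2 < size c)%N -> x \in c -> next c x != prev c x.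
Proof.
move=> uc sc /rot_to[n [|a [|b p]] E].
- by move: sc; rewrite -(size_rot n) E.
- by move: sc; rewrite -(size_rot n) E.
apply/eqP => h; have := next_prev uc x; rewrite -h -!(next_rot n uc) E /=.
move: uc; rewrite -(rot_uniq n) E /= !inE !negb_or eqxx.
move=> /andP[/and3P[xa xb _] _].
by rewrite eq_sym (negbTE xa) eqxx => bx; rewrite bx eqxx in xb.
Qed.

(** The faces containing the edge {ij} are spanned with the two neighbours of
    [j] in the link of [i]. *)
Lemma edge_in_two_faces (R : comNzRingType) i j :
  (forall v, exists c, link_is_cycle T v c) ->
  \sum_k (is_face i j k)%:R = 2 * ([set i; j]%SET \in edges T)%:R :> R.
Proof.
move=> lk; case: (boolP ([set i; j]%SET \in edges T)) => eij; last first.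
  rewrite mulr0 big1 // => k _.
  case: (boolP (is_face i j k)) => // /is_face_edge.
  by rewrite (negbTE eij).
have [c [uc sc ec fc]] := lk i.
have jc : j \in c by rewrite -ec.
have E k : (is_face i j k)%:R
    = (k == next c j)%:R * 1 + (k == prev c j)%:R * 1 :> R.
  rewrite !mulr1 -natrD; congr (_%:R); rewrite /is_face fc jc /=.
  have -> : (j == next c k) = (k == prev c j).
    by apply/eqP/eqP => ->; rewrite ?prev_next ?next_prev.
  have := next_neq_prev _ _ _ uc sc jc.
  case: (eqVneq k (next c j)) => [-> /negbTE ->|_ _] /=.
    by rewrite mem_next jc.
  case: eqVneq => [->|]; last by rewrite andbF.
  by rewrite mem_prev jc.
under eq_bigr do rewrite E.
by rewrite big_split /= !sum_pred1 mulr1.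
Qed.

(** An edge joins [A] to its complement by connectedness, and it lies in a
    face. *)
Lemma cut_face (A : {set 'I_N}) : closed_connected_surface T ->
  A != finset.set0 -> A \proper [set: 'I_N]%SET ->
  exists i j k, [/\ is_face i j k, i \in A & j \notin A].
Proof.
move=> [_ lk con] /set0Pn[x xA] /properP[_ [y _ yA]].
suff [i [j [eij iA jA]]] : exists i j,
    [/\ [set i; j]%SET \in edges T, i \in A & j \notin A].
  have : (\sum_k (is_face i j k)%:R : int) != 0.
    by rewrite edge_in_two_faces // eij.
  case: (pickP (is_face i j)) => [k fk _|nf]; first by exists i, j, k.
  by rewrite big1 ?eqxx // => k _; rewrite nf.
apply: contrapT => no; move: (con x y).
have cl : fingraph.closed (fun a b => [set a; b]%SET \in edges T) A.
  have cl' a b : [set a; b]%SET \in edges T -> a \in A -> b \in A.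
    by move=> eab aA; apply/negPn/negP => bA; apply: no; exists a, b; split.
  move=> a b /= eab; apply/idP/idP; apply: cl' => //.
  by rewrite finset.setUC.
by move=> /(closed_connect cl); rewrite xA (negbTE yA).
Qed.

Lemma euler_subcomplex (A : {set 'I_N}) :
  euler_char (subcomplex T A) = #|A|%:Z
    - #|[set e in edges T | e \subset A]%SET|%:Z
    + #|[set f in faces T | f \subset A]%SET|%:Z.
Proof.
have sgn n (P : {set {set 'I_N}}) : (forall s, s \in P -> #|s| = n) ->
    \sum_(s in P) (-1) ^+ #|s|.-1 = (-1) ^+ n.-1 * #|P|%:Z.
  move=> cP; under eq_bigr => s /cP -> do over.
  by rewrite sumr_const -mulr_natr natz.
rewrite /euler_char (bigID (mem (faces T))).
rewrite [X in _ + X = _](bigID (mem (edges T))) /=.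
have -> : #|A| = #|[set [set v]%SET | v in A]%SET|.
  by rewrite card_imset //; exact: finset.set1_inj.
have cE e : e \in edges T -> #|e| = 2%N by exact: card_edge.
have cF f : f \in faces T -> #|f| = 3%N by exact: card_face.
transitivity (\sum_(f in [set f in faces T | f \subset A]%SET) (-1) ^+ #|f|.-1 +
  (\sum_(e in [set e in edges T | e \subset A]%SET) (-1) ^+ #|e|.-1 +
   \sum_(s in [set [set v]%SET | v in A]%SET) (-1) ^+ #|s|.-1) : int).
  congr (_ + (_ + _)); apply: eq_bigl => s; rewrite !inE.
  - by case: (s \in faces T); rewrite ?orbT ?andbF ?andbT.
  - case: (boolP (s \in edges T)) => /= [es|]; last by rewrite !andbF.
    rewrite orbT andbT /=.
    by case: (boolP (s \in faces T)) => [/cF|]; rewrite ?(cE _ es) ?andbT.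
  - apply/idP/imsetP => [|[v vA ->]].
      case/andP=> /andP[/andP[]].
      case/orP=> [/orP[/imsetP[v _ ->] vA _ _|-> _ _ //]|-> _ //].
      by exists v => //; rewrite -finset.sub1set.
    have nE : [set v]%SET \notin edges T.
      by apply: contraPN (cards1 v) => /cE ->.
    have nF : [set v]%SET \notin faces T.
      by apply: contraPN (cards1 v) => /cF ->.
    by rewrite nE nF finset.sub1set vA imset_f.
rewrite (sgn 3%N) ?(sgn 1%N [set [set v]%SET | v in A]%SET) ?(sgn 2%N).
- by rewrite /=; ring.
- by move=> e; rewrite inE => /andP[/cE].
- by move=> s /imsetP[v _ ->]; rewrite cards1.
- by move=> f; rewrite inE => /andP[/cF].
Qed.

End Surface.

(** * Sums over the corners of the faces *)

Section FaceSum.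
Context {R : comNzRingType} {N : nat} (T : complex2 N).
Implicit Types (i j k : 'I_N) (G H : 'I_N -> 'I_N -> 'I_N -> R).

(** Each face contributes through its six orderings, so that a sum over its
    corners becomes invariant under renaming the vertices. *)
Definition face_sum G : R :=
  \sum_i \sum_j \sum_k (is_face T i j k)%:R * G i j k.

Lemma eq_face_sum G H : (forall i j k, is_face T i j k -> G i j k = H i j k) ->
  face_sum G = face_sum H.
Proof.
move=> GH; do 3![apply: eq_bigr => ? _].
by case: (boolP (is_face _ _ _ _)) => [/GH->|]; rewrite ?mul0r.
Qed.

Lemma face_sumD G H :
  face_sum (fun i j k => G i j k + H i j k) = face_sum G + face_sum H.
Proof.
by rewrite -big_split; do 2![apply: eq_bigr => ? _; rewrite -big_split];
  apply: eq_bigr => ? _; rewrite mulrDr.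
Qed.

Lemma face_sumZ x G : face_sum (fun i j k => x * G i j k) = x * face_sum G.
Proof.
by rewrite mulr_sumr; do 2![apply: eq_bigr => ? _; rewrite mulr_sumr];
  apply: eq_bigr => ? _; rewrite mulrCA.
Qed.

Lemma face_sum_rot G : face_sum (fun i j k => G j k i) = face_sum G.
Proof.
rewrite /face_sum.
under eq_bigr do (under eq_bigr do under eq_bigr do rewrite is_face_rot).
rewrite exchange_big /=; apply: eq_bigr => i _.
by rewrite exchange_big.
Qed.

Lemma face_sum_edges (g : 'I_N -> 'I_N -> R) :
  (forall v, exists c, link_is_cycle T v c) ->
  face_sum (fun i j _ => g i j) =
  2 * \sum_i \sum_j ([set i; j]%SET \in edges T)%:R * g i j.
Proof.
move=> lk; rewrite mulr_sumr; apply: eq_bigr => i _.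
rewrite mulr_sumr; apply: eq_bigr => j _.
by rewrite -mulr_suml edge_in_two_faces // mulrA.
Qed.

(** The right-hand sum is the one used for the curvature, with each corner
    counted once instead of twice. *)
Lemma face_sum_half G : (forall i j k, is_face T i j k -> G i j k = G i k j) ->
  face_sum G = 2 * \sum_i \sum_(j < N) \sum_(k < N | (j < k)%N
                               && ([set i; j; k]%SET \in faces T)) G i j k.
Proof.
move=> Gsym; rewrite mulr_sumr; apply: eq_bigr => i _.
rewrite [2]/(1 + 1) mulrDl mul1r.
have -> : \sum_(j < N)
    \sum_(k < N | (j < k)%N && ([set i; j; k]%SET \in faces T)) G i j k
   = \sum_(j < N) \sum_(k < N) (j < k)%N%:R * ((is_face T i j k)%:R * G i j k).
  apply: eq_bigr => j _; rewrite big_mkcond; apply: eq_bigr => k _.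
  rewrite mulrA -natrM mulnb -/(is_face T i j k).
  by case: (_ && _); rewrite ?mul1r ?mul0r.
rewrite [X in _ = X + _]exchange_big -big_split; apply: eq_bigr => j _ /=.
rewrite -big_split; apply: eq_bigr => k _ /=.
rewrite (is_face_swap T i k j).
case: (boolP (is_face T i j k)) => fc; last first.
  by rewrite !mul0r !mulr0 addr0.
rewrite !mul1r (Gsym _ _ _ fc) -mulrDl -natrD.
have : j != k by apply: (is_face_neq T j k i); rewrite -is_face_rot.
by rewrite -val_eqE /=; case: ltngtP; rewrite ?mul1r.
Qed.
End FaceSum.

(** * Curvature of angle systems *)

Section AngleSystem.
Context {R : realType} {N : nat} (T : complex2 N).
Context (lk : forall v, exists c, link_is_cycle T v c).
Context (I : {set 'I_N} -> R).
Implicit Types (i j k : 'I_N) (A : {set 'I_N}).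
Implicit Types (theta : 'I_N -> 'I_N -> 'I_N -> R).

Definition angle_curvature theta i : R :=
  2 * pi - \sum_(j < N) \sum_(k < N | (j < k)%N
                               && ([set i; j; k]%SET \in faces T)) theta i j k.

(** [theta i j k] is the angle at [i] of the face {ijk}. *)
Definition angle_system theta :=
  (forall i j k, is_face T i j k -> theta i j k = theta i k j) /\
  (forall i j k, is_face T i j k ->
    theta i j k + theta j k i + theta k i j = pi).

Definition link_term A i j k : R :=
  ((i \in A) && (j \notin A) && (k \notin A))%:R
  * (pi - Lambda (I [set j; k]%SET)).

(** The factor of [pi] is 1 if at least two of the vertices are in [A], and 0
    otherwise. *)
Definition slack A theta i j k : R :=
  let a v : R := (v \in A)%:R in
  pi * (a i * a j + a j * a k + a k * a i - 2 * a i * a j * a k)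
  + (link_term A i j k + link_term A j k i + link_term A k i j)
  - (a i * theta i j k + a j * theta j k i + a k * theta k i j).

Lemma face_sum_Lk A :
  face_sum T (link_term A) = 2 * \sum_(p in Lk T A) (pi - Lambda (I p.1)).
Proof.
pose P v := [set e in edges T |
  [&& [disjoint e & A], v \in A & (v |: e)%SET \in faces T]]%SET.
have -> : \sum_(p in Lk T A) (pi - Lambda (I p.1)) =
    \sum_v \sum_(e in P v) (pi - Lambda (I e)).
  rewrite pair_big_dep.
  rewrite /= (reindex (fun p : 'I_N * {set 'I_N} => (p.2, p.1))) /=.
    by apply: eq_bigl => -[v e]; rewrite !inE.
  by exists (fun p => (p.2, p.1)) => -[].
rewrite mulr_sumr; apply: eq_bigr => v _.
rewrite -(sum_pairs (P v) (fun e => pi - Lambda (I e))); last first.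
  by move=> e; rewrite inE => /andP[/card_edge].
apply: eq_bigr => j _; apply: eq_bigr => k _.
rewrite /link_term mulrA -natrM mulnb; congr (_%:R * _); congr nat_of_bool.
rewrite inE finset.setUA -/(is_face T v j k).
case: (boolP (is_face T v j k)) => fc; last by rewrite !andbF.
have -> : [set j; k]%SET \in edges T.
  by apply: (is_face_edge T j k v); rewrite -is_face_rot.
rewrite finset.disjoints_subset finset.subUset !finset.sub1set !inE /= andbT.
by do 3![case: (_ \in A)].
Qed.

(** In each face the angles at the vertices of [A] are pi times the indicator
    of having at least two vertices in [A], plus the link term, minus the slack.
    With [a] the indicator of [A], that indicator is the symmetrization of
    [a i * a j] minus [2 * a i * a j * a k]; summed over faces these count the
    edges (in two faces each) and the faces of F_A, and
    2 pi |A| - 2 pi |E_A| + 2 pi |F_A| = 2 pi chi(F_A). *)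
Lemma sum_angle_curvature A theta : angle_system theta ->
  \sum_(i in A) angle_curvature theta i =
  - (\sum_(p in Lk T A) (pi - Lambda (I p.1)))
  + 2 * pi * (euler_char (subcomplex T A))%:~R
  + face_sum T (slack A theta) / 6.
Proof.
move=> [sym _].
pose a v : R := (v \in A)%:R.
pose aT i j k := a i * theta i j k.
pose aaa i j k := a i * a j * a k.
pose aa i j (k : 'I_N) := a i * a j.
have -> : face_sum T (slack A theta) =
    3 * pi * face_sum T aa - 2 * pi * face_sum T aaa
    + 3 * face_sum T (link_term A) - 3 * face_sum T aT.
  pose rot (G : 'I_N -> 'I_N -> 'I_N -> R) i j k := G i j k + G j k i + G k i j.
  have rotE G : face_sum T (rot G) = 3 * face_sum T G.
    rewrite /rot !face_sumD face_sum_rot.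
    by rewrite (face_sum_rot T (fun i j k => G j k i)) face_sum_rot; ring.
  have -> : face_sum T (slack A theta) =
      face_sum T (fun i j k => pi * rot aa i j k + (- 2 * pi) * aaa i j k
        + rot (link_term A) i j k + (- 1) * rot aT i j k).
    apply: eq_face_sum => i j k _; rewrite /slack /rot /aT /aaa /aa /= -!/(a _).
    by ring.
  rewrite (face_sumD _ (fun i j k => pi * rot aa i j k + (- 2 * pi) * aaa i j k
        + rot (link_term A) i j k)) (face_sumD _ (fun i j k => pi * rot aa i j k
        + (- 2 * pi) * aaa i j k))
    (face_sumD _ (fun i j k => pi * rot aa i j k)).
  by rewrite !face_sumZ !rotE; ring.
have -> : face_sum T aa = 4 * #|[set e in edges T | e \subset A]%SET|%:R.
  rewrite /aa (face_sum_edges _ (fun i j => a i * a j) lk).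
  have -> : 4 * #|[set e in edges T | e \subset A]%SET|%:R = 2 * (2 *
      \sum_(e in [set e in edges T | e \subset A]%SET) 1) :> R.
    by rewrite sumr_const; ring.
  congr (2 * _); rewrite -(sum_pairs _ (fun=> 1)); last first.
    by move=> e; rewrite inE => /andP[/card_edge].
  apply: eq_bigr => i _; apply: eq_bigr => j _.
  rewrite mulr1 /a -!natrM !mulnb; congr (_%:R); congr nat_of_bool.
  by rewrite inE finset.subUset !finset.sub1set.
have -> : face_sum T aaa = 6 * #|[set f in faces T | f \subset A]%SET|%:R.
  rewrite -sum_triples; last by move=> e; rewrite inE => /andP[/card_face].
  do 3![apply: eq_bigr => ? _].
  rewrite /aaa /a -!natrM !mulnb; congr (_%:R); congr nat_of_bool.
  by rewrite inE !finset.subUset !finset.sub1set.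
rewrite face_sum_Lk (face_sum_half T aT) => [|i j k fc]; last first.
  by rewrite /aT sym.
rewrite euler_subcomplex !(intrD, intrN, =^~ pmulrn) sumrB sumr_const.
rewrite -[(2 * pi) *+ _]mulr_natr.
have -> : \sum_(i in A) \sum_(j < N) \sum_(k < N | (j < k)%N
        && ([set i; j; k]%SET \in faces T)) theta i j k
    = \sum_i \sum_(j < N) \sum_(k < N | (j < k)%N
        && ([set i; j; k]%SET \in faces T)) aT i j k.
  rewrite big_mkcond; apply: eq_bigr => i _; rewrite /aT /a.
  under [RHS]eq_bigr do rewrite -mulr_sumr; rewrite -mulr_sumr.
  by case: (i \in A); rewrite ?mul1r ?mul0r.
set M := \sum_i _; set L := \sum_(p in _) _.
by field.
Qed.

End AngleSystem.

(** Gauss-Bonnet: for the full vertex set the link is empty and the slack of a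
    face is pi minus the sum of its angles. The inversive distance appearing in
    these two terms is then arbitrary. *)
Lemma angle_curvature_total (R : realType) (N : nat) (T : complex2 N)
    (theta : 'I_N -> 'I_N -> 'I_N -> R) :
  (forall v, exists c, link_is_cycle T v c) -> angle_system T theta ->
  \sum_i angle_curvature T theta i = 2 * pi * (euler_char (cells T))%:~R.
Proof.
move=> lk sys; pose A := [set: 'I_N]%SET.
pose I0 := fun _ : {set 'I_N} => 0 : R.
have cT : subcomplex T A = cells T.
  by apply/finset.setP => s; rewrite inE finset.subsetT andbT.
have := sum_angle_curvature T lk I0 A _ sys; rewrite cT.
under eq_bigl do rewrite inE.
move=> ->; rewrite big1 => [|p]; last first.
  rewrite inE finset.disjoints_subset finset.setCT finset.subset0.
  by move=> /and4P[/card_edge c /eqP e]; rewrite e cards0 in c.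
have -> : face_sum T (slack I0 A theta) = 0; last by rewrite mul0r; ring.
rewrite (eq_face_sum T _ (fun _ _ _ => 0 * 0)) ?face_sumZ ?mul0r // => i j k fc.
by rewrite /slack /link_term !inE /= -[pi](sys.2 _ _ _ fc); ring.
Qed.

(** The strict bounds make the slack nonnegative on every face, and positive on
    a face with vertices both in [A] and outside. *)
Lemma angle_curvature_in_Y (R : realType) (N : nat) (T : complex2 N)
    (I : {set 'I_N} -> R) (theta : 'I_N -> 'I_N -> 'I_N -> R) :
  closed_connected_surface T ->
  angle_system T theta ->
  (forall i j k, is_face T i j k ->
    0 < theta i j k < pi - Lambda (I [set j; k]%SET)) ->
  Y T I (\row_i angle_curvature T theta i).
Proof.
move=> surf sys bnd; have [_ lk _] := surf; split => /=.
  by under eq_bigr do rewrite mxE; exact: angle_curvature_total.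
move=> A [A0 Ap]; rewrite /Y_ /=.
rewrite [ltRHS](eq_bigr (angle_curvature T theta)) => [|i _]; last first.
  by rewrite mxE.
rewrite (sum_angle_curvature T lk I) // ltrDl divr_gt0 //.
have pos i j k : is_face T i j k -> 0 <= slack I A theta i j k /\
    (i \in A -> j \notin A -> 0 < slack I A theta i j k).
  move=> f1; have f2 : is_face T j k i by rewrite -is_face_rot.
  have f3 : is_face T k i j by rewrite -is_face_rot.
  have b1 := bnd _ _ _ f1; have b2 := bnd _ _ _ f2; have b3 := bnd _ _ _ f3.
  have tot := sys.2 _ _ _ f1.
  rewrite /slack /link_term.
  by case: (i \in A); case: (j \in A); case: (k \in A) => /=;
    split => // *; lra.
have [x [y [z [fc xA yA]]]] := cut_face T A surf A0 Ap.
have term i j k : 0 <= (is_face T i j k)%:R * slack I A theta i j k.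
  by case: (boolP (is_face T i j k)) => [/pos[? _]|]; rewrite ?mul1r ?mul0r.
have term1 i j : 0 <= \sum_k (is_face T i j k)%:R * slack I A theta i j k.
  exact: sumr_ge0.
have gt : 0 < slack I A theta x y z by exact: (pos _ _ _ fc).2.
apply: lt_le_trans gt _.
rewrite /face_sum (bigD1 x) //= (bigD1 y) //= (bigD1 z) //= fc mul1r.
move: (slack I A theta x y z) => s.
by rewrite -!addrA lerDl !addr_ge0 // !sumr_ge0 // => ? _; rewrite sumr_ge0.
Qed.

(** * The extended curvature of a generalized metric *)

Lemma Lambda_le_pihalf (R : realType) (x : R) : 0 <= x -> Lambda x <= pi / 2.
Proof.
move=> x0; rewrite /Lambda.
have -> : (x <= -1) = false by apply/negbTE; rewrite -ltNge; lra.
case: (leP x 1) => x1; last by rewrite divr_ge0 ?pi_ge0.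
by rewrite -acos0; apply: ler_acos; lra.
Qed.

Section Metric.
Context {R : realType} {N : nat} (T : complex2 N).
Context (I : {set 'I_N} -> R) (hI : forall e, e \in edges T -> 0 <= I e).
Context (r : 'rV[R]_N) (r_gt0 : pos_orthant r).
Implicit Types i j k : 'I_N.

Lemma edge_lengthC i j : edge_length I r i j = edge_length I r j i.
Proof.
by rewrite /edge_length finset.setUC [_ ^+ 2 + _]addrC [2 * _ * _]mulrAC.
Qed.

Lemma edge_length_ge i j : [set i; j]%SET \in edges T ->
  Num.sqrt (r ord0 i ^+ 2 + r ord0 j ^+ 2) <= edge_length I r i j.
Proof.
move=> /hI I0; rewrite /edge_length ler_wsqrtr // lerDl.
by rewrite !mulr_ge0 // ltW //; exact: r_gt0.
Qed.

Lemma edge_length_gt0 i j :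
  [set i; j]%SET \in edges T -> 0 < edge_length I r i j.
Proof.
move=> /edge_length_ge; apply: lt_le_trans.
by rewrite sqrtr_gt0 addr_gt0 // exprn_gt0 //; exact: r_gt0.
Qed.

Lemma is_face_edges i j k : is_face T i j k ->
  [/\ [set i; j]%SET \in edges T, [set i; k]%SET \in edges T
    & [set j; k]%SET \in edges T].
Proof.
move=> f; split; first exact: is_face_edge f.
  by rewrite is_face_swap in f; exact: is_face_edge f.
by rewrite is_face_rot in f; exact: is_face_edge f.
Qed.

Lemma inner_angle_system : angle_system T (inner_angle I r).
Proof.
split=> i j k /is_face_edges[eij eik ejk]; rewrite /inner_angle.
  by rewrite ext_angleC (edge_lengthC k).
rewrite (edge_lengthC k i) (edge_lengthC j i) (edge_lengthC k j).
rewrite [X in _ + X + _]ext_angleC.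
rewrite -(ext_angle_sum _ (edge_length I r j k) (edge_length I r i j)
  (edge_length I r i k)) ?edge_length_gt0 //.
by rewrite -!addrA; congr (_ + _); rewrite addrC; congr (_ + _);
  exact: ext_angleC.
Qed.

Lemma inner_angle_bounds i j k : is_face T i j k ->
  0 <= inner_angle I r i j k <= pi - Lambda (I [set j; k]%SET).
Proof.
move=> /is_face_edges[eij eik ejk]; rewrite ext_angle_ge0 ?edge_length_gt0 //=.
apply: (ext_angle_le_pi_sub_Lambda _ (r ord0 i)); try exact: r_gt0.
- exact: hI.
- exact: edge_length_ge.
- exact: edge_length_ge.
Qed.

(** The angle pi / 3 is admissible on every face, because Lambda is at most
    pi / 2 on nonnegative numbers. *)
Definition mixed_angle (t : R) i j k : R :=
  (1 - t) * inner_angle I r i j k + t * (pi / 3).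

Lemma mixed_angle_system t : angle_system T (mixed_angle t).
Proof.
have [sym tot] := inner_angle_system.
split=> i j k f; rewrite /mixed_angle; first by rewrite sym.
have := tot _ _ _ f.
set x := inner_angle _ _ _ _ _; set y := inner_angle _ _ _ _ _.
by set z := inner_angle _ _ _ _ _ => <-; field.
Qed.

Lemma mixed_angle_bounds t i j k : 0 < t < 1 -> is_face T i j k ->
  0 < mixed_angle t i j k < pi - Lambda (I [set j; k]%SET).
Proof.
move=> t01 f; have b := inner_angle_bounds _ _ _ f.
have [_ _ /hI/Lambda_le_pihalf L] := is_face_edges _ _ _ f.
have p0 := pi_gt0 R; rewrite /mixed_angle; nra.
Qed.

Lemma mixed_angle_curvature t i : angle_curvature T (mixed_angle t) i =
  ext_curvature T I r i + t * (angle_curvature T (fun _ _ _ => pi / 3) i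
                               - ext_curvature T I r i).
Proof.
pose total (g : 'I_N -> 'I_N -> R) := \sum_(j < N)
  \sum_(k < N | (j < k)%N && ([set i; j; k]%SET \in faces T)) g j k.
have totalE : total (mixed_angle t i) =
    (1 - t) * total (inner_angle I r i) + t * total (fun _ _ => pi / 3).
  rewrite /total !mulr_sumr -big_split; apply: eq_bigr => j _.
  by rewrite !mulr_sumr -big_split.
rewrite /angle_curvature /ext_curvature -!/(total _) totalE; ring.
Qed.

(** The curvatures of the mixed angles lie in [Y] for [0 < t < 1] and converge
    to the extended curvature as [t] tends to 0. *)
Lemma ext_curvature_closure : closed_connected_surface T ->
  closure (Y T I) (\row_i ext_curvature T I r i).
Proof.
move=> surf B [P hP PB].
pose x t : 'rV[R]_N := \row_i angle_curvature T (mixed_angle t) i.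
have hx : \forall t \near (0 : R)^'+, forall (i : 'I_1) j, P i j (x t i j).
  apply: filter_forall => i; apply: filter_forall => j.
  have cv : x t i j @[t --> 0^'+] --> (\row_i ext_curvature T I r i) i j.
    rewrite mxE; under eq_fun do rewrite mxE mixed_angle_curvature.
    set K := ext_curvature T I r j; set D := _ - K.
    apply: cvg_at_right_filter.
    suff : K + t * D @[t --> (0 : R)] --> K + 0 * D by rewrite mul0r addr0.
    apply: cvgD; first exact: cvg_cst.
    by apply: cvgM; [exact: cvg_id|exact: cvg_cst].
  exact: cv (hP i j).
near (0:R)^'+ => t.
exists (x t); split; last by apply: PB; near: t.
have t0 : 0 < t by [].
have t1 : t < 1 by [].
apply: angle_curvature_in_Y => //; first exact: mixed_angle_system.
by move=> i j k; apply: mixed_angle_bounds; rewrite t0 t1.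
Unshelve. all: by end_near.
Qed.

End Metric.

Theorem corollary7p5 (R : realType) (N : nat) (T : complex2 N)
    (hT : closed_connected_surface T)
    (I : {set 'I_N} -> R) (hI : forall e, e \in edges T -> 0 <= I e)
    (alpha : R)
    (hr : exists r : 'rV[R]_N, pos_orthant r /\
      forall i j, ext_alpha_curvature T I alpha r i
                  = ext_alpha_curvature T I alpha r j) :
  [/\ (0 < euler_char (cells T) ->
         closure (Y T I) `&` pos_orthant !=set0),
      (euler_char (cells T) < 0 ->
         closure (Y T I) `&` neg_orthant !=set0) &
      (euler_char (cells T) = 0 ->
         closure (Y T I) `&` [set 0] !=set0)].
Proof.
have [r [r0 cst]] := hr; have [N0 lk _] := hT.
have clK := ext_curvature_closure T I hI r r0 hT.
pose c := ext_alpha_curvature T I alpha r (Ordinal N0).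
have ra0 i : 0 < r ord0 i `^ alpha by apply: powR_gt0; exact: r0.
have Kc i : ext_curvature T I r i = c * r ord0 i `^ alpha.
  by rewrite /c (cst _ i) /ext_alpha_curvature divfK // gt_eqF.
pose m := \sum_i r ord0 i `^ alpha.
have m0 : 0 < m.
  rewrite /m (bigD1 (Ordinal N0)) //= ltr_wpDr // sumr_ge0 // => i _.
  exact/ltW.
have cm : c * m = 2 * pi * (euler_char (cells T))%:~R.
  rewrite -(angle_curvature_total _ _ T _ lk
    (inner_angle_system T I hI r r0)).
  by rewrite mulr_sumr; apply: eq_bigr => i _; rewrite -Kc.
have p0 := pi_gt0 R.
split => chi.
- exists (\row_i ext_curvature T I r i); split => // i.
  rewrite mxE Kc mulr_gt0 //.
  by rewrite -(pmulr_lgt0 _ m0) cm !mulr_gt0 // ltr0z.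
- exists (\row_i ext_curvature T I r i); split => // i.
  rewrite mxE Kc pmulr_llt0 //.
  by rewrite -(pmulr_llt0 _ m0) cm pmulr_rlt0 ?mulr_gt0 // ltrz0.
- exists (\row_i ext_curvature T I r i); split => //.
  apply/rowP => i; rewrite !mxE Kc.
  have /eqP : c * m = 0 by rewrite cm chi mulr0.
  by rewrite mulf_eq0 (gt_eqF m0) orbF => /eqP ->; rewrite mul0r.
Qed.
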